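(* For each integer $r\ge 3$, define $\gamma_r:=2/\sqrt{r}$. Then $$1-\mu\big(r,0,\gamma_r A+(1-\gamma_r)B\big)\sim 2\gamma_r\quad\text{as } r\to\infty,$$ regardless of initial capital, where $\mu(r,0,\gamma A+(1-\gamma)B)$ is the rate of profit defined in the context.
   Context: Here $a_r\sim b_r$ as $r\to\infty$ means $a_r/b_r\to 1$. (Note $\gamma_r\in(0,1)$ for $r\ge5$, so the mixture is defined for all $r\geq 5$, which is all that matters for the limit.) A $p$-coin is a coin with probability $p$ of heads. A player has an integer-valued capital; in each game the player wins one unit with heads and loses one unit with tails. In game $A$ a fair coin is tossed. In game $B$ (with integer parameter $r\ge3$ and real parameter $\rho\in[0,1)$) a $p_0$-coin is tossed if the current capital is a multiple of $r$, and a $p_1$-coin otherwise, where $p_0=\rho^{r-1}/(1+\rho^{r-1})$ and $p_1=1/(1+\rho)$. Here $\rho=0$, so $p_0=0$ and $p_1=1$: in game $B$ the player surely loses one unit if capital is a multiple of $r$ and surely wins one unit otherwise. For $\gamma\in(0,1)$, the random mixture $\gamma A+(1-\gamma)B$ means that at each turn, independently, game $A$ is played with probability $\gamma$ and game $B$ is played otherwise. Thus, for $\rho=0$, capital is a nearest-neighbor Markov chain on $\mathbb{Z}$ which moves from $x$ to $x+1$ with probability $\frac{\gamma}{2}$ if $r\mid x$ and $1-\frac{\gamma}{2}$ if $r\nmid x$, and otherwise moves to $x-1$. If $S_n$ denotes the cumulative profit (current capital minus initial capital) after $n$ turns, the rate of profit $\mu(r,0,\gamma A+(1-\gamma)B)$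 is the constant to which $n^{-1}S_n$ converges almost surely as $n\to\infty$. *)

(* Defs.v *)
From HB Require Import structures.
From mathcomp Require Import all_boot all_order all_algebra.
From mathcomp Require Import all_classical all_reals all_analysis.

Set Implicit Arguments.
Unset Strict Implicit.
Unset Printing Implicit Defensive.

Import Order.TTheory GRing.Theory Num.Theory.
Import numFieldNormedType.Exports.

Local Open Scope classical_set_scope.
Local Open Scope ring_scope.

(* A game maps the current capital to the probability of winning one unit
   at the next turn; otherwise one unit is lost. *)
Definition game (R : realType) := int -> R.

Definition game_A (R : realType) : game R := fun _ => 2^-1.

Definition game_B (R : realType) (r : nat) (rho : R) : game R := fun x =>
  if (r %| x)%Z then rho ^+ r.-1 / (1 + rho ^+ r.-1) else (1 + rho)^-1.

(* [g] is played with probability [c] and [h] otherwise, by a choice made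
   afresh at each turn, independently of everything else. *)
Definition mixture (R : realType) (c : R) (g h : game R) : game R :=
  fun x => c * g x + (1 - c) * h x.

Definition transition (R : realType) (g : game R) (x y : int) : R :=
  if y == x + 1 then g x else if y == x - 1 then 1 - g x else 0.

(* [X n] is the capital after [n] turns of [g], from initial capital [x0].
   The first clause is measurability for the discrete sigma-algebra on [int];
   the last one is the Markov property
     P(X_(n+1) = y | X_0 = x 0, ..., X_n = x n) = transition g (x n) y
   multiplied by the probability of the conditioning event, so that it is
   meaningful when this event is negligible. *)
Record capital_process (R : realType) (g : game R) (x0 : int)
    (d : measure_display) (T : measurableType d) (P : probability T R)
    (X : nat -> T -> int) : Prop := CapitalProcess {
  capital_measurable : forall n (B : set int), measurable (X n @^-1` B) ;
  capital_initial : P [set w | X 0%N w = x0] = 1%E ;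
  capital_markov : forall (n : nat) (x : nat -> int) (y : int),
    P [set w | (forall i, (i <= n)%N -> X i w = x i) /\ X n.+1 w = y] =
    (P [set w | forall i, (i <= n)%N -> X i w = x i]
      * (transition g (x n) y)%:E)%E }.

Definition profit (T : Type) (X : nat -> T -> int) (n : nat) (w : T) : int :=
  X n w - X 0%N w.

(* The probability space and the initial capital are universally quantified:
   the rate of profit is one and the same constant for all of them. *)
Definition is_rate_of_profit (R : realType) (g : game R) (m : R) : Prop :=
  forall (x0 : int) (d : measure_display) (T : measurableType d)
    (P : probability T R) (X : nat -> T -> int),
  capital_process g x0 P X ->
  {ae P, forall w, (profit X n w)%:~R / n%:R @[n --> \oo] --> m}.

(* Junk value 0 if [g] has no rate of profit. *)
Definition rate_of_profit (R : realType) (g : game R) : R :=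
  xget 0 [set m | is_rate_of_profit g m].

Definition mu (R : realType) (r : nat) (rho c : R) : R :=
  rate_of_profit (mixture c (game_A R) (game_B r rho)).

Definition gamma_ (R : realType) (r : nat) : R := 2 / Num.sqrt r%:R.

Definition asymp_equiv (R : realType) (a b : nat -> R) : Prop :=
  a n / b n @[n --> \oo] --> (1 : R).

(* Main.v *)
(** Capital drifts at rate [m] as soon as the Poisson equation
    [g x H(x+1) + (1 - g x) H(x-1) = H x + m] has a solution [H] at bounded
    distance from the identity: [H (X n) - n m] is then a martingale with bounded
    increments, its fourth moment is [O(n^2)], and Borel-Cantelli gives
    [X n / n --> m] almost surely. When [g] depends only on the capital modulo
    [r], the increments [D] of [H] are [r]-periodic, satisfy a first-order linear
    recurrence and sum to [r] over a period. For the mixture with [rho = 0],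
    [q = c / 2], [p = 1 - q] and [s = q / p], this gives [D k = a + b s ^ k] and
      [m = r (1 - c) / (r + 2 (1 - s ^ r) / (s (1 - s ^ (r - 2))))].
    With [c = 2 / sqrt r], [s] is equivalent to [1 / sqrt r], hence [1 - m] to
    [c + 2 / sqrt r = 2 c]. *)
Require Import Defs.
From HB Require Import structures.
From mathcomp Require Import all_boot all_order all_algebra.
From mathcomp Require Import all_classical all_reals all_analysis.
From mathcomp Require Import ring lra zify.
Import Order.TTheory GRing.Theory Num.Theory.
Import numFieldNormedType.Exports.
Local Open Scope classical_set_scope.
Local Open Scope ring_scope.

(** * Fourth moment of a bounded-increment martingale *)

(** The transition operator of the chain: [iter n (step g) phi x] stands for the mean of [phi] at
    the capital after [n] turns from [x], with no integral to handle. *)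
Definition step {R : realType} (g : game R) (phi : int -> R) (x : int) : R :=
  g x * phi (x + 1) + (1 - g x) * phi (x - 1).

Definition proper_game {R : realType} (g : game R) :=
  forall x, 0 <= g x <= 1.

Lemma step_le {R : realType} {g : game R} (phi psi : int -> R) :
  proper_game g -> (forall x, phi x <= psi x) ->
  forall x, step g phi x <= step g psi x.
Proof.
move=> g01 le x; have /andP[g0 g1] := g01 x.
by apply: lerD; apply: ler_wpM2l; rewrite ?subr_ge0.
Qed.

Lemma iter_step_le {R : realType} {g : game R} n (phi psi : int -> R) :
  proper_game g -> (forall x, phi x <= psi x) ->
  forall x, iter n (step g) phi x <= iter n (step g) psi x.
Proof. by move=> g01 le; elim: n => //= n; apply: step_le. Qed.

Lemma iter_stepZ {R : realType} (g : game R) n c (phi : int -> R) x :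
  iter n (step g) (fun y => c * phi y) x = c * iter n (step g) phi x.
Proof.
elim: n x => //= n IH x; rewrite /step !IH; ring.
Qed.

(* [v] is the conditional mean of [H - c] after [n] steps from [x]. The quadratic
   term makes the induction on the first step go through: averaging [(v + y) ^ 4]
   over the two increments [y] produces [6 v ^ 2 y ^ 2]. *)
Lemma martingale_fourth_moment {R : realType} (g : game R) (H : int -> R)
    (K m c : R) :
  proper_game g -> (forall x, step g H x = H x + m) ->
  (forall x, `|H (x + 1) - H x - m| <= K) ->
  (forall x, `|H (x - 1) - H x - m| <= K) ->
  forall n x, let v := H x + n%:R * m - c in
  iter n (step g) (fun y => (H y - c) ^+ 4) x
    <= v ^+ 4 + 8 * K ^+ 2 * n%:R * v ^+ 2 + 4 * K ^+ 4 * n%:R ^+ 2.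
Proof.
move=> g01 Hm HK1 HK2; elim=> [|n IH] x /=; first by rewrite !mul0r mulr0; nra.
apply: le_trans (step_le _ _ g01 IH x) _; rewrite /step.
have /andP[p0 p1] := g01 x; have := Hm x; rewrite /step.
set p := g x in p0 p1 *; set q := 1 - p.
have q0 : 0 <= q by rewrite subr_ge0.
set a := H (x + 1) - H x - m; set b := H (x - 1) - H x - m => drift.
have ab : p * a + q * b = 0 by rewrite /a /b; move: drift; rewrite /q; lra.
set v := H x + n.+1%:R * m - c.
have -> : H (x + 1) + n%:R * m - c = v + a by rewrite /v /a -(natr1 n); ring.
have -> : H (x - 1) + n%:R * m - c = v + b by rewrite /v /b -(natr1 n); ring.
have aK : `|a| <= K by exact: HK1.
have bK : `|b| <= K by exact: HK2.
have K0 : 0 <= K := le_trans (normr_ge0 _) aK.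
have sq y : `|y| <= K -> y ^+ 2 <= K ^+ 2.
  by move=> yK; rewrite -real_normK ?num_real// lerXn2r ?nnegrE.
(* The cubic term obeys [4 v y^3 <= 2 v^2 y^2 + 2 y^4], that is [2 y^2 (v - y)^2 >= 0]; hence the
   coefficients 8 = 6 + 2 and 3 = 1 + 2. *)
have quad y : `|y| <= K ->
  (v + y) ^+ 4 <= v ^+ 4 + 4 * v ^+ 3 * y + 8 * K ^+ 2 * v ^+ 2 + 3 * K ^+ 4.
  move=> /sq yK2.
  have y0 := sqr_ge0 y; have v0 := sqr_ge0 v.
  have y4 : y ^+ 4 <= K ^+ 4 by nra.
  have : 4 * v * y ^+ 3 <= 2 * v ^+ 2 * K ^+ 2 + 2 * K ^+ 4.
    have e1 : 4 * v * y ^+ 3 <= 2 * (v ^+ 2 * y ^+ 2) + 2 * y ^+ 4.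
      by have := sqr_ge0 (y * (v - y)); nra.
    have := ler_wpM2l v0 yK2; nra.
  have := ler_wpM2l v0 yK2; nra.
have sqr y : `|y| <= K -> (v + y) ^+ 2 <= v ^+ 2 + 2 * v * y + K ^+ 2.
  by move=> /sq; nra.
set N : R := n%:R; rewrite -(natr1 n) -/N.
have N0 : 0 <= N by exact: ler0n.
(* A majorant affine in [y]: its average over the two increments depends only on their mean
   [p * a + q * b], which is zero. *)
set F := fun y => v ^+ 4 + 4 * v ^+ 3 * y + 8 * K ^+ 2 * v ^+ 2 + 3 * K ^+ 4 +
   8 * K ^+ 2 * N * (v ^+ 2 + 2 * v * y + K ^+ 2) + 4 * K ^+ 4 * N ^+ 2.
have bnd y : `|y| <= K -> (v + y) ^+ 4 + 8 * K ^+ 2 * N * (v + y) ^+ 2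
    + 4 * K ^+ 4 * N ^+ 2 <= F y.
  move=> yK; rewrite /F lerD2r lerD ?quad//.
  by rewrite ler_wpM2l ?sqr// !mulr_ge0// sqr_ge0.
apply: (@le_trans _ _ (p * F a + q * F b)).
  by apply: lerD; apply: ler_wpM2l => //; apply: bnd.
have -> : p * F a + q * F b =
    F 0 + (p * a + q * b) * (4 * v ^+ 3 + 16 * K ^+ 2 * N * v).
  by rewrite /F /q; ring.
rewrite ab mul0r addr0 /F.
(* [F 0] lies below the target by exactly [K ^+ 4]. *)
have : 0 <= K ^+ 4 by rewrite exprn_ge0.
nra.
Qed.

(** * The Markov property over several steps *)

Lemma transition_up {R : realType} (g : game R) x : transition g x (x + 1) = g x.
Proof. by rewrite /transition eqxx. Qed.

Lemma transition_down {R : realType} (g : game R) x :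
  transition g x (x - 1) = 1 - g x.
Proof. by rewrite /transition eqxx; case: eqP => //; lia. Qed.

Definition history {T : Type} (X : nat -> T -> int) n (x : nat -> int) : set T :=
  [set w | forall i, (i <= n)%N -> X i w = x i].

Lemma historyS {T : Type} (X : nat -> T -> int) n x :
  history X n.+1 x = history X n x `&` (X n.+1 @^-1` [set x n.+1]).
Proof.
apply/seteqP; split=> w /=.
  by move=> h; split=> [i lin|]; apply: h => //; apply: leq_trans lin _.
move=> [h1 h2] i; rewrite leq_eqVlt => /predU1P[->//|]; exact: h1.
Qed.

Lemma eq_history {T : Type} (X : nat -> T -> int) n (x y : nat -> int) :
  (forall i, (i <= n)%N -> x i = y i) -> history X n x = history X n y.
Proof.
by move=> xy; apply/seteqP; split=> w h i lin; rewrite h ?xy.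
Qed.

Lemma history0 {T : Type} (X : nat -> T -> int) x :
  history X 0 x = X 0%N @^-1` [set x 0%N].
Proof.
apply/seteqP; split=> w /= h; first exact: h.
by move=> i; rewrite leqn0 => /eqP->.
Qed.

Lemma measurable_history {d} {T : measurableType d} (X : nat -> T -> int) n x :
  (forall i B, measurable (X i @^-1` B)) -> measurable (history X n x).
Proof.
move=> mX; elim: n => [|n IH]; first by rewrite history0.
by rewrite historyS; apply: measurableI.
Qed.

Section markov.
Context {R : realType} {g : game R} {x0 : int} {d : measure_display}.
Context {T : measurableType d} {P : probability T R} {X : nat -> T -> int}.
Hypothesis XP : capital_process g x0 P X.
Local Open Scope ereal_scope.

Let mX i B : measurable (X i @^-1` B).
Proof. exact: (capital_measurable XP). Qed.

Lemma history_markov n x y : P (history X n x `&` (X n.+1 @^-1` [set y])) =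
  P (history X n x) * (transition g (x n) y)%:E.
Proof. exact: (capital_markov XP). Qed.

(** The transition probabilities of the two moves add up to 1, so by the Markov property these moves
    exhaust the mass of the history. *)
Lemma history_other n x : P (history X n x `\`
  (X n.+1 @^-1` [set (x n + 1)%R; (x n - 1)%R])) = 0.
Proof.
pose C := history X n x; pose U := X n.+1 @^-1` [set (x n + 1)%R; (x n - 1)%R].
rewrite -/C -/U.
have mC : measurable C by apply: measurable_history.
have mU : measurable U by apply: mX.
have PCU : P (C `&` U) = P C.
  rewrite /U /C preimage_setU setIUr.
  transitivity (P (history X n x `&` X n.+1 @^-1` [set (x n + 1)%R]) +
                P (history X n x `&` X n.+1 @^-1` [set (x n - 1)%R])).
    apply: measureU; last by rewrite -subset0 => w /= [[_ ->] [_]]; lia.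
    - by apply: measurableI => //; apply: mX.
    - by apply: measurableI => //; apply: mX.
  rewrite !history_markov transition_up transition_down -/C.
  rewrite -(fineK (fin_num_measure P C mC)) -!EFinM -EFinD; congr EFin.
  by ring.
have PD : P (C `\` U) + P (C `&` U) = P C by apply/esym; exact: measureDI.
have fC := fineK (fin_num_measure P _ mC).
have fD := fineK (fin_num_measure P _ (measurableD mC mU)).
move: PD; rewrite PCU -fC -fD => -[PD]; congr EFin; lra.
Qed.

(* Conditioning on the first step after the history, rather than on the last one,
   avoids any sum over paths. *)
Lemma history_step_le (n k : nat) (x : nat -> int) (B : set int) :
  P (history X k x `&` X (k + n)%N @^-1` B)
    <= P (history X k x) * (iter n (step g) \1_B (x k))%:E.
Proof.
elim: n k x => [|n IH] k x.
  rewrite addn0 /= indicE; have [xB|xB] := boolP (x k \in B).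
    rewrite mule1; apply: le_measure => //; rewrite ?inE.
    - by apply: measurableI (mX _ _); exact: measurable_history.
    - exact: measurable_history.
  rewrite mule0 (_ : _ `&` _ = set0) ?measure0// -subset0 => w [/= h].
  by rewrite (h k)// => hB; move: xB; rewrite notin_setE; apply.
have mH := measurable_history X k x mX.
set U := X k.+1 @^-1` [set (x k + 1)%R; (x k - 1)%R].
set S := X (k + n.+1)%N @^-1` B.
have next y : P (history X k x `&` X k.+1 @^-1` [set y] `&` S) <=
    P (history X k x) * (transition g (x k) y * iter n (step g) \1_B y)%:E.
  (* Extending the history by [y] reduces the claim to the induction hypothesis at [k.+1]. *)
  pose x' i := if (i <= k)%N then x i else y.
  have hx' : history X k x = history X k x'.
    by apply: eq_history => i ik; rewrite /x' ik.
  have yx' : x' k.+1 = y by rewrite /x' ltnn.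
  have := IH k.+1 x'.
  by rewrite historyS -hx' yx' addSnnS history_markov EFinM muleA.
(* Split by the turn that follows the history; the last piece is null by [history_other]. *)
have cover : history X k x `&` S `<=`
    (history X k x `&` X k.+1 @^-1` [set (x k + 1)%R] `&` S) `|`
    ((history X k x `&` X k.+1 @^-1` [set (x k - 1)%R] `&` S) `|`
    (history X k x `\` U)).
  move=> w [h Sw]; have [[]|] := pselect (U w); [left|right; left|right; right];
    by [].
apply: (le_trans (le_measure P _ _ cover)).
- by rewrite inE; apply: measurableI => //; apply: mX.
- rewrite inE; apply: measurableU; last apply: measurableU.
  + by apply: measurableI => //; [apply: measurableI|apply: mX].
  + by apply: measurableI => //; [apply: measurableI|apply: mX].
  + by apply: measurableD => //; apply: mX.
apply: (le_trans (measureU2 _ _ _)).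
- by apply: measurableI => //; [apply: measurableI|apply: mX].
- apply: measurableU.
  + by apply: measurableI => //; [apply: measurableI|apply: mX].
  + by apply: measurableD => //; apply: mX.
apply: (le_trans (leeD2l _ (measureU2 _ _ _))).
- by apply: measurableI => //; [apply: measurableI|apply: mX].
- by apply: measurableD => //; apply: mX.
apply: (le_trans (leeD (next _) (leeD (next _) (_ : _ <= 0)))).
  by rewrite -(history_other k x).
rewrite adde0 transition_up transition_down.
rewrite -(fineK (fin_num_measure P _ mH)) -!EFinM -EFinD lee_fin iterS /step.
by rewrite -mulrDr.
Qed.

(** The capital starts at [x0] only almost surely, so the bound for the one-point history is
    completed by the null complement of that history. *)
Lemma capital_tail_le n (B : set int) :
  P (X n @^-1` B) <= (iter n (step g) \1_B x0)%:E.
Proof.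
have P0 : P (history X 0 (fun=> x0)) = 1.
  by rewrite history0; exact: (capital_initial XP).
have mH := measurable_history X 0 (fun=> x0) mX.
have : X n @^-1` B `<=` (history X 0 (fun=> x0) `&` X n @^-1` B) `|`
    ~` history X 0 (fun=> x0).
  by move=> w Bw; have [h|h] := pselect (history X 0 (fun=> x0) w); [left|right].
move=> /(le_measure P).
rewrite !inE => /(_ (mX _ _) (measurableU _ _ (measurableI _ _ mH (mX _ _))
  (measurableC mH))) h.
apply: (le_trans h); apply: (le_trans (measureU2 _ _ _)).
- exact: measurableI.
- exact: measurableC.
rewrite -[leRHS]adde0; apply: leeD; last first.
  by rewrite -(subee (x := 1))// -{2}P0 -probability_setC.
by have := history_step_le n 0 (fun=> x0) B; rewrite P0 mul1e.
Qed.
End markov.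

(** * The strong law *)

(** By telescoping, since [1 / x^2 <= 2 / x - 2 / (x + 1)] for [x >= 1]. *)
Lemma sum_inv_sqr_le {R : realType} n :
  \sum_(0 <= i < n) (i.+1%:R ^+ 2)^-1 <= 2 - 2 / n.+1%:R :> R.
Proof.
elim: n => [|n IH]; first by rewrite big_geq// divr1 subrr.
rewrite big_nat_recr//=; apply: le_trans (lerD IH (lexx _)) _.
set x : R := n.+1%:R; rewrite -(natr1 n.+1) -/x.
have x1 : 1 <= x by rewrite /x ler1n.
have x0 : x != 0 by rewrite gt_eqF//; lra.
have x10 : x + 1 != 0 by rewrite gt_eqF//; lra.
rewrite -subr_ge0.
have -> : 2 - 2 / (x + 1) - (2 - 2 / x + (x ^+ 2)^-1) =
  (x - 1) / (x ^+ 2 * (x + 1)).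
  by clearbody x; field; rewrite x10 x0.
by rewrite divr_ge0 ?mulr_ge0 ?exprn_ge0//; lra.
Qed.

Lemma inv_sqr_series_lty {R : realType} (M : R) (u : (\bar R)^nat) :
  (forall n, 0 <= u n)%E -> (forall n, u n <= (M / n.+1%:R ^+ 2)%:E)%E ->
  (\sum_(n <oo) u n < +oo)%E.
Proof.
move=> u0 uM.
have M0 : 0 <= M.
  by have := le_trans (u0 0%N) (uM 0%N); rewrite expr1n divr1 lee_fin.
apply: (@le_lt_trans _ _ (M * 2)%:E); last exact: ltry.
apply: lime_le; first by apply: is_cvg_nneseries.
apply: nearW => n; apply: (@le_trans _ _ (\sum_(0 <= i < n) (M / i.+1%:R ^+ 2)%:E)%E).
  by apply: lee_sum.
rewrite sumEFin lee_fin -mulr_sumr ler_wpM2l//.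
apply: le_trans (sum_inv_sqr_le n) _.
by rewrite gerBl divr_ge0.
Qed.

(** Markov's inequality for the fourth power, carried through the iterates of [step] by
    monotonicity. The fourth moment yields a summable bound; the second would only yield order
    [1 / n]. *)
Lemma capital_deviation_le {R : realType} (g : game R) (H : int -> R) (m C : R)
    (x0 : int) d (T : measurableType d) (P : probability T R) X (e : R) n :
  proper_game g -> (forall x, step g H x = H x + m) ->
  (forall x, `|H x - x%:~R| <= C) -> capital_process g x0 P X -> 0 < e ->
  (P (X n.+1 @^-1` [set y | (e * n.+1%:R < `|H y - H x0 - n.+1%:R * m|)%R])
   <= (4 * (2 * C + 1 + `|m|) ^+ 4 / e ^+ 4 / n.+1%:R ^+ 2)%:E)%E.
Proof.
move=> g01 Hm HC XP e0; set K := 2 * C + 1 + `|m|; set B := [set y | _].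
(* In [K], the distance from [H] to the identity at both ends costs [2 * C], the move itself 1 and
   the drift [|m|]. *)
have HK (b : int) x : `|b%:~R : R| = 1 -> `|H (x + b) - H x - m| <= K.
  move=> b1; rewrite (_ : _ - m = (H (x + b) - (x + b)%:~R) -
    (H x - x%:~R) + b%:~R - m); last by rewrite intrD; ring.
  apply: le_trans (ler_normB _ _) _; rewrite lerD2r.
  apply: le_trans (ler_normD _ _) _; rewrite b1 lerD2r.
  by apply: le_trans (ler_normB _ _) _; rewrite mulrDl mul1r lerD.
apply: (le_trans (capital_tail_le XP _ _)); rewrite lee_fin.
set N : R := n.+1%:R; have N0 : 0 < N by rewrite ltr0n.
have eN : 0 < (e * N) ^+ 4 by rewrite exprn_gt0// mulr_gt0.
(* With this centre, [v] vanishes in [martingale_fourth_moment] and only the term in [N ^+ 2]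
   remains. *)
pose c := H x0 + N * m.
have indB y : \1_B y <= ((e * N) ^+ 4)^-1 * (H y - c) ^+ 4.
  rewrite indicE; have [/set_mem|] := boolP (y \in B); last first.
    by move=> _; rewrite mulr_ge0 ?invr_ge0 ?(ltW eN)// exprn_even_ge0.
  rewrite /B /= -/N => yB; rewrite ler_pdivlMl// mulr1 /c opprD addrA.
  rewrite -[leRHS]ger0_norm ?exprn_even_ge0// normrX lerXn2r ?nnegrE//.
    by rewrite mulr_ge0 ?ltW.
  exact: ltW.
apply: le_trans (iter_step_le n.+1 _ _ g01 indB x0) _.
rewrite iter_stepZ ler_pdivrMl//.
have /le_trans : _ <= _ := martingale_fourth_moment g H K m c g01 Hm
  (fun x => HK 1 x (normr1 _)) (fun x => HK (- 1) x (normrN1 _)) n.+1 x0.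
apply.
rewrite -/N /c subrr expr0n expr0n /= mulr0 !add0r.
rewrite le_eqVlt; apply/orP; left; apply/eqP; clearbody N; field.
by rewrite !gt_eqF.
Qed.

Lemma cvg_profit_rate {R : realType} (H : int -> R) (m C : R) (X : nat -> int) :
  (forall x, `|H x - x%:~R| <= C) ->
  (forall k : nat, \forall n \near \oo,
    `|H (X n) - H (X 0%N) - n%:R * m| <= k.+1%:R^-1 * n%:R) ->
  (X n - X 0%N)%:~R / n%:R @[n --> \oo] --> m.
Proof.
move=> HC dev; apply/cvgrPdist_le => e e0.
(* Half of [e] pays for the deviation of [H], the other half for replacing [H] by the capital at
   times [n] and 0. *)
pose k := Num.trunc (2 / e).
have ke : k.+1%:R^-1 <= e / 2.
  rewrite -[leRHS]invf_div lef_pV2 ?posrE ?ltr0n ?divr_gt0//.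
  by apply: ltW; apply: truncnS_gt.
near=> n.
have n0 : 0 < n%:R :> R by rewrite ltr0n; near: n; exact: nbhs_infty_gt.
have nC : 2 * C <= e / 2 * n%:R.
  rewrite -ler_pdivrMl ?divr_gt0//; near: n; exact: nbhs_infty_ger.
rewrite -(ler_pM2r n0) -[X in _ * X <= _](ger0_norm (ltW n0)) -normrM mulrBl.
rewrite divfK ?gt_eqF// intrB.
rewrite (_ : _ - _ = (H (X n) - (X n)%:~R) - (H (X 0%N) - (X 0%N)%:~R)
  - (H (X n) - H (X 0%N) - n%:R * m)); last by ring.
apply: le_trans (ler_normB _ _) _.
rewrite [leRHS](_ : _ = e / 2 * n%:R + e / 2 * n%:R); last by field.
apply: lerD.
  apply: le_trans (ler_normB _ _) _.
  by apply: le_trans nC; rewrite mulrDl mul1r lerD.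
apply: (le_trans (y := k.+1%:R^-1 * n%:R)); last by rewrite ler_wpM2r// ltW.
by near: n; exact: dev.
Unshelve. all: end_near. Qed.

(** Borel-Cantelli applies at each threshold [1 / (k + 1)]; these are countably many, so almost
    surely the exceedances of every threshold eventually stop. *)
Lemma rate_of_harmonic {R : realType} (g : game R) (H : int -> R) (m C : R) :
  proper_game g -> (forall x, step g H x = H x + m) ->
  (forall x, `|H x - x%:~R| <= C) -> is_rate_of_profit g m.
Proof.
move=> g01 Hm HC x0 d T P X XP.
(* Indexing by [n.+1] discards time 0, where the bound in [n^-2] makes no sense; the shift is undone
   below by [n.-1]. *)
pose F (k n : nat) : set T := X n.+1 @^-1`
  [set y | k.+1%:R^-1 * n.+1%:R < `|H y - H x0 - n.+1%:R * m|].
have mF k n : measurable (F k n) by exact: (capital_measurable XP).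
have F0 k : P (lim_sup_set (F k)) = 0%E.
  apply: lim_sup_set_cvg0 => //.
  apply: (inv_sqr_series_lty (4 * (2 * C + 1 + `|m|) ^+ 4 / k.+1%:R^-1 ^+ 4)) => // n.
  by apply: (capital_deviation_le g H m C x0) => //; rewrite invr_gt0.
have aeF : {ae P, forall w, forall k, ~ lim_sup_set (F k) w}.
  apply: ae_foralln => k; exists (lim_sup_set (F k)); split; last 1 first.
  - by move=> w /= /contrapT.
  - apply: bigcap_measurable => // i _; exact: bigcup_measurable.
  - exact: F0.
have mX0 : measurable (X 0%N @^-1` [set x0]) by exact: (capital_measurable XP).
have ae0 : {ae P, forall w, X 0%N w = x0}.
  exists (~` (X 0%N @^-1` [set x0])); split=> //; first exact: measurableC.
  transitivity (P (~` (X 0%N @^-1` [set x0]))) => //.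
  rewrite probability_setC//; have -> := capital_initial XP.
  by rewrite subee.
apply: filterS2 ae0 aeF => w X0 nF; apply: (@cvg_profit_rate R H m C (X ^~ w)) => // k.
have := nF k; rewrite /lim_sup_set /bigcap /= => /existsNP[N /not_implyP[_ hN]].
near=> n; rewrite X0 leNgt; apply/negP => Fn; apply: hN.
exists n.-1 => /=; first by rewrite -ltnS prednK//; near: n; exact: nbhs_infty_gt.
by rewrite /F /= prednK//; near: n; exact: nbhs_infty_gt.
Unshelve. all: end_near. Qed.

(** * Existence of the process and uniqueness of the rate *)

(** Lebesgue measure on [[0, 1[], a concrete sample space on which the process of any proper game is
    realised by successive subdivision. *)
Definition unit_interval_prob (R : realType) : set (measurableTypeR R) -> \bar R :=
  mrestr (@lebesgue_measure R) (measurable_itv `[0, 1[).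

HB.instance Definition _ (R : realType) :=
  Measure.copy (unit_interval_prob R)
    (mrestr (@lebesgue_measure R) (measurable_itv `[0, 1[)).

Lemma lebesgue_measure_segment {R : realType} (a l : R) : 0 <= l ->
  lebesgue_measure `[a, (a + l)[%classic = l%:E.
Proof.
move=> l0; rewrite lebesgue_measure_itv/= lte_fin -EFinB addrAC subrr add0r.
rewrite ltrDl; case: ltP => // l0'; congr EFin.
by apply/eqP; rewrite eq_le l0.
Qed.

Lemma unit_interval_prob_setT (R : realType) : unit_interval_prob R setT = 1%E.
Proof.
rewrite /unit_interval_prob /mrestr setTI -[1 in X in lebesgue_measure X]add0r.
exact: lebesgue_measure_segment.
Qed.

HB.instance Definition _ (R : realType) := @Measure_isProbability.Build _ _ R
  (unit_interval_prob R) (unit_interval_prob_setT R).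

(* The points [w] of [[a, a + l[] are the possible futures of a player whose
   capital is [x]: the left part of the interval, of relative length [g x], wins
   the next turn. *)
Fixpoint run {R : realType} (g : game R) (n : nat) (x : int) (a l w : R) : int :=
  if n is n'.+1 then
    if w < a + l * g x then run g n' (x + 1) a (l * g x) w
    else run g n' (x - 1) (a + l * g x) (l * (1 - g x)) w
  else x.

Lemma measurable_run {R : realType} (g : game R) n x a l (B : set int) :
  measurable ((run g n x a l : measurableTypeR R -> int) @^-1` B).
Proof.
elim: n x a l => [|n IH] x a l /=.
  have [xB|xB] := pselect (B x).
    by rewrite (_ : _ @^-1` B = setT)//; apply/seteqP; split.
  by rewrite (_ : _ @^-1` B = set0)// -subset0.
set c := a + l * g x.
rewrite (_ : _ @^-1` B =
  (`]-oo, c[%classic `&` (run g n (x + 1) a (l * g x) @^-1` B)) `|`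
  (`[c, +oo[%classic `&` (run g n (x - 1) c (l * (1 - g x)) @^-1` B))).
  by apply: measurableU; apply: measurableI => //; exact: measurable_itv.
apply/seteqP; split=> w /=; rewrite !in_itv /= ?andbT.
  by case: ltP => wc Bw; [left|right].
by move=> [[->]//|[]]; rewrite leNgt => /negbTE ->.
Qed.

(** Induction on the first turn: it cuts the interval at [a + l * g x], and each part poses the same
    problem with the history shifted by one. *)
Lemma run_history_measure {R : realType} (g : game R) n x a l (y : nat -> int) :
  proper_game g -> 0 <= l ->
  lebesgue_measure (history (fun i => run g i x a l) n y `&` `[a, (a + l)[%classic)
  = ((y 0%N == x)%:R * l * \prod_(i < n) transition g (y i) (y i.+1))%:E.
Proof.
move=> g01; elim: n x a l y => [|n IH] x a l y l0.
  rewrite big_ord0 mulr1 history0 /=; case: eqP => [yx|/eqP yx].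
    rewrite mul1r (_ : _ @^-1` _ = setT) ?setTI ?lebesgue_measure_segment//.
    by apply/seteqP; split=> //= w _; rewrite yx.
  rewrite mul0r (_ : _ @^-1` _ = set0) ?set0I ?measure0//.
  by rewrite -subset0 => w /= /esym/eqP; rewrite (negbTE yx).
have /andP[p0 p1] := g01 x.
case: eqP => [yx|/eqP yx]; last first.
  rewrite !mul0r (_ : _ `&` _ = set0) ?measure0//.
  rewrite -subset0 => w /= [h _]; have := h 0%N isT => /= /esym/eqP.
  by rewrite (negbTE yx).
set c := a + l * g x; pose y' i := y i.+1.
have p0' : 0 <= l * g x by rewrite mulr_ge0.
have q0' : 0 <= l * (1 - g x) by rewrite mulr_ge0 ?subr_ge0.
have cl : c + l * (1 - g x) = a + l by rewrite /c; ring.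
rewrite (_ : _ `&` _ =
  (history (fun i => run g i (x + 1) a (l * g x)) n y' `&` `[a, c[%classic) `|`
  (history (fun i => run g i (x - 1) c (l * (1 - g x))) n y'
     `&` `[c, (c + l * (1 - g x))[%classic)).
  have mH x' a' l' : @measurable _ (measurableTypeR R)
      (history (fun i => run g i x' a' l') n y').
    by apply: measurable_history => i B; exact: measurable_run.
  rewrite [LHS]measureU; last 3 first.
  - by apply: measurableI => //; exact: measurable_itv.
  - by apply: measurableI => //; exact: measurable_itv.
  - rewrite -subset0 => w /= [[_]]; rewrite !in_itv /= => /andP[_ wc] [_].
    by move=> /andP[]; rewrite leNgt wc.
  rewrite [X in (X + _)%E](IH _ _ _ _ p0') [X in (_ + X)%E](IH _ _ _ _ q0').
  rewrite -EFinD big_ord_recl.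
  set Q := \prod_(i < n) transition g (y' i) (y' i.+1).
  rewrite -[y' 0%N]/(y 1%N) /= yx mul1r.
  congr EFin.
  (* At most one of the two parts starts from [y 1]; if neither does, both sides are zero. *)
  rewrite /transition; case: eqP => [->|_].
    rewrite (_ : (x + 1 == x - 1) = false); last by apply/eqP; lia.
    by rewrite !mul0r addr0 mul1r mulrA.
  by case: eqP => _; rewrite !(mul0r, mulr0, mul1r, add0r) ?mulrA.
rewrite cl; apply/seteqP; split=> w /=; rewrite !in_itv /=.
  move=> [h /andP[aw wl]]; case: (ltP w c) => wc.
    by left; rewrite aw; split=> // i lin; have := h i.+1 lin; rewrite /= -/c wc.
  right; rewrite wl; split=> // i lin; have := h i.+1 lin.
  by rewrite /= -/c ltNge wc.
move=> [[h /andP[aw wc]]|[h /andP[cw wl]]].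
  split; last by rewrite aw/=; apply: lt_le_trans wc _; rewrite -cl lerDl.
  by move=> [_|i lin] /=; rewrite ?yx// -/c wc; exact: h.
split; last by rewrite wl andbT; apply: le_trans cw; rewrite lerDl.
by move=> [_|i lin] /=; rewrite ?yx// -/c ltNge cw; exact: h.
Qed.

Lemma capital_process_run {R : realType} (g : game R) x0 : proper_game g ->
  capital_process g x0 (unit_interval_prob R : probability _ R)
    (fun n => run g n x0 0 1).
Proof.
move=> g01.
have hP n y : (unit_interval_prob R : probability _ R)
    (history (fun n => run g n x0 0 1) n y) =
    ((y 0%N == x0)%:R * \prod_(i < n) transition g (y i) (y i.+1))%:E.
  rewrite -[_%:R]mulr1 -(run_history_measure g n x0 0 1 y g01 ler01).
  by rewrite [LHS]/= /unit_interval_prob /mrestr add0r.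
split=> [n B|/=|n y z].
- exact: measurable_run.
- rewrite (_ : [set w | _] = setT); first exact: unit_interval_prob_setT.
  by apply/seteqP; split.
- pose y' i := if (i <= n)%N then y i else z.
  have yy' i : (i <= n)%N -> y' i = y i by rewrite /y' => ->.
  have zy' : y' n.+1 = z by rewrite /y' ltnn.
  rewrite [X in _ X = _](_ : _ = history (fun n => run g n x0 0 1) n.+1 y').
    rewrite [X in (_ X * _)%E](_ : _ = history (fun n => run g n x0 0 1) n y)//.
    rewrite !hP -EFinM big_ord_recr /= zy' !yy'// mulrA; congr (_ * _ * _)%:E.
    by apply: eq_bigr => i _; rewrite !yy'// ltnW.
  by rewrite historyS zy' (eq_history _ _ _ _ yy').
Qed.

(* If no process existed, every real would vacuously be a rate of profit. *)
Lemma is_rate_of_profit_unique {R : realType} (g : game R) m1 m2 :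
  proper_game g -> is_rate_of_profit g m1 -> is_rate_of_profit g m2 -> m1 = m2.
Proof.
move=> g01 h1 h2; have XP := capital_process_run g 0 g01.
(* Since the total mass is positive, the almost-everywhere filter is proper, and some path has both
   limits. *)
have : ProperFilter (almost_everywhere (unit_interval_prob R : probability _ R)).
  apply: ae_properfilter_algebraOfSetsType.
  rewrite [ltRHS](_ : _ = 1%E) ?lte01//; exact: unit_interval_prob_setT.
move=> PF.
have [w [c1 c2]] := filter_ex (filterI (h1 _ _ _ _ _ XP) (h2 _ _ _ _ _ XP)).
exact: (cvg_unique _ c1 c2).
Qed.

Lemma rate_of_profit_eq {R : realType} (g : game R) m :
  proper_game g -> is_rate_of_profit g m -> rate_of_profit g = m.
Proof.
move=> g01 hm; apply: (is_rate_of_profit_unique _ _ _ g01) => //.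
by apply: (@xgetPex _ 0 (is_rate_of_profit g)); exists m.
Qed.

(** * The rate of profit for [rho = 0] *)

Definition residue (r : nat) (x : int) : nat := `|(x %% r)%Z|%N.

Lemma ltn_residue r x : (0 < r)%N -> (residue r x < r)%N.
Proof.
move=> r0; rewrite /residue -ltz_nat gez0_abs ?ltz_pmod ?ltz_nat//.
by rewrite modz_ge0// eqz_nat -lt0n.
Qed.

Lemma residue_eq r x : (0 < r)%N -> x = (x %/ r)%Z * r%:Z + (residue r x)%:Z.
Proof.
move=> r0; rewrite /residue gez0_abs; first exact: divz_eq.
by rewrite modz_ge0// eqz_nat -lt0n.
Qed.

Lemma residue_uniq r (q : int) k : (k < r)%N -> residue r (q * r%:Z + k%:Z) = k.
Proof. by move=> kr; rewrite /residue modzMDl modz_small//= kr. Qed.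

Lemma dvdz_residue (r : nat) x : (r %| x)%Z = (residue r x == 0%N).
Proof. by rewrite /residue absz_eq0; apply/dvdz_mod0P/eqP. Qed.

Lemma residueD1 r x : (0 < r)%N ->
  residue r (x + 1) = if (residue r x).+1 == r then 0%N else (residue r x).+1.
Proof.
move=> r0; have := ltn_residue r x r0; rewrite {2}(residue_eq r x r0).
set k := residue r x; set q := (x %/ r)%Z; move=> kr.
case: eqP => [rk|/eqP rk].
  rewrite (_ : _ + 1 = (q + 1) * r%:Z + 0%N%:Z); first exact: residue_uniq.
  by rewrite -{1}rk; lia.
rewrite (_ : _ + 1 = q * r%:Z + k.+1%:Z); last by lia.
by apply: residue_uniq; rewrite ltn_neqAle rk.
Qed.

(** The function [H] with increments [D] is the identity plus the partial sums of [D - 1]. These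
    vanish over a full period because [D] sums to [r], so the correction is periodic, hence
    bounded. *)
Lemma is_rate_of_profit_periodic {R : realType} (g : game R) (r : nat)
    (D : nat -> R) (m : R) :
  (0 < r)%N -> proper_game g -> \sum_(i < r) D i = r%:R ->
  (forall x, g x * D (residue r x) - (1 - g x) * D (residue r (x - 1)) = m) ->
  is_rate_of_profit g m.
Proof.
move=> r0 g01 sumD driftD.
pose h k := \sum_(i < k) (D i - 1).
pose H x := x%:~R + h (residue r x).
have h0 : h 0%N = 0 by rewrite /h big_ord0.
have hr : h r = 0 by rewrite /h sumrB sumD sumr_const card_ord subrr.
have HD x : H (x + 1) = H x + D (residue r x).
  rewrite /H residueD1// intrD.
  have hS k : h k.+1 = h k + (D k - 1) by rewrite /h big_ord_recr.
  case: eqP => [rk|_]; last by rewrite hS; ring.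
  have := hS (residue r x); rewrite rk hr h0; lra.
apply: (@rate_of_harmonic R g H m (\sum_(i < r) `|D i - 1|)) => // x.
  have := HD (x - 1); rewrite subrK /step HD -(driftD x) => Hx.
  rewrite (_ : H (x - 1) = H x - D (residue r (x - 1))); last by rewrite Hx addrK.
  ring.
rewrite /H addrAC subrr add0r; apply: le_trans (ler_norm_sum _ _ _) _.
have kr := ltnW (ltn_residue r x r0).
rewrite (big_ord_widen _ (fun i => `|D i - 1|) kr).
by rewrite big_mkcond /=; apply: ler_sum => i _; case: ifP.
Qed.

Lemma mixture_rho0E {R : realType} (r : nat) (c : R) x : (1 < r)%N ->
  mixture c (game_A R) (game_B r 0) x = if (r %| x)%Z then c / 2 else 1 - c / 2.
Proof.
case: r => [|[|r]]// _; rewrite /mixture /game_A /game_B exprS mul0r.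
by case: ifP => _; rewrite ?addr0 ?invr1 ?mul0r; field.
Qed.

Definition profit_rate {R : realType} (r : nat) (c : R) : R :=
  let s := c / 2 / (1 - c / 2) in
  r%:R * (1 - c) / (r%:R + 2 / s * ((1 - s ^+ r) / (1 - s ^+ r.-2))).

Lemma proper_mixture_rho0 {R : realType} (r : nat) (c : R) : (1 < r)%N ->
  0 < c < 1 -> proper_game (mixture c (game_A R) (game_B r 0)).
Proof.
by move=> r1 /andP[c0 c1] x; rewrite mixture_rho0E//; case: ifP => _; lra.
Qed.

Lemma is_rate_of_profit_rho0 {R : realType} (r : nat) (c : R) : (2 < r)%N ->
  0 < c < 1 ->
  is_rate_of_profit (mixture c (game_A R) (game_B r 0)) (profit_rate r c).
Proof.
case: r => [|[|[|r']]]// _ c01; set r := r'.+3; have r0 : (0 < r)%N by [].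
have g01 : proper_game (mixture c (game_A R) (game_B r 0)).
  exact: proper_mixture_rho0.
have /andP[c0 c1] := c01.
rewrite /profit_rate; set q := c / 2; set p := 1 - q; set s := q / p.
have q0 : 0 < q by rewrite /q; lra.
have p0 : 0 < p by rewrite /p /q; lra.
have qE : q = p * s by rewrite /s; field; rewrite gt_eqF.
have cE : 1 - c = p * (1 - s) by rewrite mulrBr -qE /p /q; field.
have s0 : 0 < s by rewrite divr_gt0.
have s1 : s < 1 by rewrite ltr_pdivrMr// /p /q; lra.
have spow n : s ^+ n.+1 < 1 by rewrite exprn_ilt1// ltW.
(* The bound [r >= 3] keeps this exponent positive. *)
have S0 : 0 < 1 - s ^+ r.-2 by rewrite subr_gt0; exact: spow.
set L := r%:R + _; set m := _ / L.
have L0 : 0 < L.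
  rewrite /L ltr_wpDr ?ltr0n// mulr_ge0 ?divr_ge0 ?ltW// subr_gt0; exact: spow.
(* Off the multiples of [r] the recurrence is [p D(k+1) - q D(k) = m], with constant solution
   [m / (p - q) = r / L] and homogeneous solution [s ^ k]. At a multiple, [q D(0) - p D(r-1) = m]
   becomes [b q (1 - s ^ (r - 2)) = 2 m], as [p s = q]. *)
pose b := 2 * m / (q * (1 - s ^+ r.-2)).
pose D i := r%:R / L + b * s ^+ i.
have geom n : (1 - s) * (\sum_(i < n) s ^+ i) = 1 - s ^+ n.
  by rewrite -[1 in RHS](expr1n _ n) subrXX; congr (_ * _);
     apply: eq_bigr => i _; rewrite expr1n mul1r.
have s1' : 1 - s != 0 by rewrite subr_eq0 gt_eqF.
have bE : b = 2 * r%:R * (1 - s) / (L * s * (1 - s ^+ r.-2)).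
  rewrite /b /m cE qE; field; by rewrite !gt_eqF.
apply: (@is_rate_of_profit_periodic R _ r D) => //.
  (* This normalisation is what dictates the value of [L]. *)
  rewrite /D big_split /= sumr_const card_ord -mulr_sumr.
  rewrite bE -[\sum_(i < r) _](mulKf s1') geom.
  rewrite -[_ / L *+ r]mulr_natr -[RHS](divfK (lt0r_neq0 L0)) {4}/L.
  clearbody L; set N : R := r%:R; set u := s ^+ r; set v := 1 - s ^+ r.-2 in S0 *.
  clearbody N u v; field.
  by rewrite s1' !gt_eqF.
move=> x; rewrite mixture_rho0E// dvdz_residue.
have := residueD1 r (x - 1) r0; rewrite subrK.
have := ltn_residue r (x - 1) r0.
set k := residue r (x - 1) => kr ->.
have mE : m = r%:R / L * (p * (1 - s)) by rewrite /m cE mulrAC.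
case: (k.+1 =P r) => [rk|_] /=; rewrite -/q -/p.
  rewrite /D (_ : k = r.-1) ?expr0; last by rewrite -rk.
  rewrite mE bE qE /= (exprS s r'.+1); clearbody L.
  by set u := s ^+ r'.+1 in S0 *; clearbody u; field; rewrite !gt_eqF.
rewrite (_ : 1 - p = p * s); last by rewrite /p -qE; ring.
rewrite /D mE exprS; ring.
Qed.

(** * Asymptotics *)

Lemma cvg_inv_sqrt {R : realType} :
  (Num.sqrt r%:R)^-1 @[r --> \oo] --> (0 : R).
Proof.
apply/cvgr0Pnorm_le => e e0; near=> r.
have r0 : 0 < r%:R :> R by rewrite ltr0n; near: r; exact: nbhs_infty_gt.
rewrite ger0_norm ?invr_ge0 ?sqrtr_ge0// -[leRHS]invrK.
rewrite lef_pV2 ?posrE ?sqrtr_gt0 ?invr_gt0//.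
rewrite -(ger0_norm (ltW (_ : 0 < e^-1))) ?invr_gt0// -sqrtr_sqr ler_wsqrtr//.
by near: r; exact: nbhs_infty_ger.
Unshelve. all: end_near. Qed.

Lemma gamma_bounds (R : realType) (r : nat) : (4 < r)%N -> 0 < gamma_ R r < 1.
Proof.
move=> r4; have r0 : (4 : R) < r%:R by rewrite ltr_nat.
have sq2 : 2 < Num.sqrt r%:R :> R.
  rewrite -[ltLHS](ger0_norm (ler0n _ 2)) -sqrtr_sqr ltr_sqrt; last by lra.
  by lra.
by rewrite /gamma_ divr_gt0 ?ltr_pdivrMr; lra.
Qed.

Lemma mu_rho0E {R : realType} (r : nat) (c : R) : (2 < r)%N -> 0 < c < 1 ->
  mu r 0 c = profit_rate r c.
Proof.
move=> r2 c01; apply: rate_of_profit_eq; last exact: is_rate_of_profit_rho0.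
by apply: proper_mixture_rho0 => //; apply: ltnW.
Qed.

(** Substituting [r = u^-2] and [gamma_ R r = 2 u] removes the indeterminate form: the right-hand
    side is continuous at [u = 0], [C = 1], with value 1. *)
Lemma deficit_ratioE {R : realType} (r : nat) : (4 < r)%N ->
  let u : R := (Num.sqrt r%:R)^-1 in let s := u / (1 - u) in
  let C := (1 - s ^+ r) / (1 - s ^+ r.-2) in
  (1 - profit_rate r (gamma_ R r)) / (2 * gamma_ R r) =
  (2 + 2 * (1 - u) * C) / (4 * (1 + 2 * u * (1 - u) * C)).
Proof.
move=> r4 u s C; have /andP[g0 g1] := gamma_bounds R r r4.
have gE : gamma_ R r = 2 * u by [].
have r0 : 0 < r%:R :> R by rewrite ltr0n (leq_ltn_trans _ r4).
have u0 : 0 < u by rewrite invr_gt0 sqrtr_gt0.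
have u2 : u < 2^-1 by move: g1; rewrite gE; lra.
have rE : r%:R = (u ^+ 2)^-1 by rewrite /u exprVn invrK sqr_sqrtr ?ltW.
have s0 : 0 < s by rewrite divr_gt0//; lra.
have s1 : s < 1 by rewrite ltr_pdivrMr; lra.
have C0 : 0 < C.
  rewrite divr_gt0// subr_gt0 exprn_ilt1 ?ltW//.
  - by case: r r4 {gE g0 g1 r0 u u0 u2 rE s s0 s1 C}.
  - by case: r r4 {gE g0 g1 r0 u u0 u2 rE s s0 s1 C} => [|[|[]]].
rewrite /profit_rate gE (_ : 2 * u / 2 = u); last by field.
rewrite -/s -/C rE /s; clearbody C.
have D0 : 0 < 1 + 2 * u * (1 - u) * C.
  by rewrite ltr_wpDr// !mulr_ge0 ?ltW//; lra.
have u1 : 1 - u != 0 by rewrite gt_eqF//; lra.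
have un : u != 0 by rewrite gt_eqF.
clearbody u; have -> : (u ^+ 2)^-1 + 2 / (u / (1 - u)) * C =
   (1 + 2 * u * (1 - u) * C) / u ^+ 2 by field; rewrite u1 un.
field; rewrite un gt_eqF//.
Qed.

Lemma cvg_deficit_ratio {R : realType} :
  (1 - profit_rate r (gamma_ R r)) / (2 * gamma_ R r) @[r --> \oo] --> (1 : R).
Proof.
pose u r : R := (Num.sqrt r%:R)^-1.
have cu : u r @[r --> \oo] --> 0 by exact: cvg_inv_sqrt.
pose s r := u r / (1 - u r).
have cs : s r @[r --> \oo] --> 0.
  rewrite -[X in _ --> X](mul0r ((1 - 0 : R)^-1)).
  apply: cvgM => //; apply: cvgV; first by rewrite subr0 oner_neq0.
  by apply: cvgB => //; exact: cvg_cst.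
(* The exponent varies with [r], so the power is squeezed between 0 and [s r]; this uses [s r <= 1],
   which follows from [u r < 1 / 2] when [r > 4]. *)
have cspow (k : nat -> nat) : (forall r, (4 < r)%N -> (0 < k r)%N) ->
    s r ^+ k r @[r --> \oo] --> 0.
  move=> k0; apply: (squeeze_cvgr _ (cvg_cst 0) cs).
  near=> r; have r4 : (4 < r)%N by near: r; exact: nbhs_infty_gt.
  have u0 : 0 <= u r by rewrite invr_ge0 sqrtr_ge0.
  have /andP[_ g1] := gamma_bounds R r r4.
  have u2 : u r < 2^-1 by move: g1; rewrite /gamma_ -/(u r); lra.
  have s0 : 0 <= s r by rewrite divr_ge0//; lra.
  have s1 : s r <= 1 by rewrite ler_pdivrMr; lra.
  by rewrite exprn_ge0//= -[leRHS]expr1 ler_wiXn2l// k0.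
pose C r := (1 - s r ^+ r) / (1 - s r ^+ r.-2).
have cC : C r @[r --> \oo] --> (1 : R).
  rewrite -[X in _ --> X](_ : (1 - 0) / (1 - 0) = 1 :> R); last first.
    by rewrite subr0 divr1.
  apply: cvgM; last apply: cvgV; first last.
  - apply: cvgB; [exact: cvg_cst|apply: cspow].
    by case=> [|[|[]]].
  - by rewrite subr0 oner_neq0.
  - apply: cvgB; [exact: cvg_cst|apply: cspow].
    by case.
have c1u : 1 - u r @[r --> \oo] --> (1 : R).
  by rewrite -[X in _ --> X](subr0 1); apply: cvgB => //; exact: cvg_cst.
apply: cvg_trans (_ : (2 + 2 * (1 - u r) * C r) /
    (4 * (1 + 2 * u r * (1 - u r) * C r)) @[r --> \oo] --> (1 : R)).
  apply: near_eq_cvg; near=> r; apply/esym/deficit_ratioE.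
  by near: r; exact: nbhs_infty_gt.
rewrite -[X in _ --> X](_ : (2 + 2 * 1 * 1) / (4 * (1 + 2 * 0 * 1 * 1)) = 1 :> R);
  last by field.
have c2 (a : R) : a @[r --> \oo] --> a by exact: cvg_cst.
apply: cvgM.
  by apply: cvgD => //; apply: cvgM => //; apply: cvgM.
apply: cvgV; first by rewrite mulr0 !mul0r addr0 mulr1 pnatr_eq0.
apply: cvgM => //; apply: cvgD => //; apply: cvgM => //; apply: cvgM => //.
exact: cvgM.
Unshelve. all: end_near. Qed.

(** The first conjunct certifies that [mu] is a genuine rate of profit here and not the default
    value 0 of [xget]. *)
Theorem corollary5 (R : realType) :
  (forall r : nat, (5 <= r)%N ->
     is_rate_of_profit (mixture (gamma_ R r) (game_A R) (game_B r (0 : R)))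
       (mu r (0 : R) (gamma_ R r))) /\
  asymp_equiv (fun r : nat => 1 - mu r (0 : R) (gamma_ R r))
              (fun r : nat => 2 * gamma_ R r).
Proof.
have muE r : (4 < r)%N -> mu r 0 (gamma_ R r) = profit_rate r (gamma_ R r).
  by move=> r4; rewrite mu_rho0E ?gamma_bounds// (leq_trans _ r4).
split=> [r r4|].
  rewrite muE//; apply: is_rate_of_profit_rho0; last exact: gamma_bounds.
  by rewrite (leq_trans _ r4).
apply: cvg_trans cvg_deficit_ratio; apply: near_eq_cvg; near=> r.
by rewrite muE//; near: r; exact: nbhs_infty_gt.
Unshelve. all: end_near. Qed.
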